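(* Let $A,B$ be finite-dimensional quantum systems, $d=\min(d_A,d_B)$. For any bipartite pure state $|\psi\rangle=\sum_{i=1}^{d}C_i|i\rangle_A|i\rangle_B$ (written in a Schmidt basis), the Hamiltonian $H$ that maximizes the entanglement generation rate $\Gamma(\psi,H)$ among Hamiltonians with bounded energy variance (bound normalized to $1$) satisfies the following set of equations: $$\sum_{i=1}^{d}C_ik_i=0,\qquad \sum_{i=1}^{d}k_i^2=1,\qquad C_i\log(C_i)-2\lambda_1k_i-\lambda_2C_i=0\quad(i=1,\dots,d),$$ where $\lambda_1$ and $\lambda_2$ are Lagrange multipliers enforcing the respective constraints and $\sum_{i=1}^{d}k_i|ii\rangle:=H_I|\psi\rangle$.
   Context: For a pure bipartite state $|\psi\rangle$ and a Hermitian operator (Hamiltonian) $H$ on $A\otimes B$, $\Gamma(\psi,H):=\frac{d}{dt}E\big(e^{-iHt}|\psi\rangle\langle\psi|e^{iHt}\big)\big|_{t=0}$, where $E$ is the relative entropy of entanglement; on pure states $E$ equals the entanglement entropy $-\mathrm{Tr}(\rho_A\log\rho_A)$, $\rho_A=\mathrm{Tr}_B|\psi\rangle\langle\psi|$. The $C_i$ are the Schmidt coefficients of $|\psi\rangle$, taken positive. The energy variance is $\Delta E^2(\psi,H)=\langle\psi|H^2|\psi\rangle-\langle\psi|H|\psi\rangle^2$; bounded variance, with the bound normalized to $1$, means $\Delta E^2(\psi,H)\le 1$. $H_I$ is the (real, antisymmetric) matrix of imaginary parts of the entries of $H$ in the Schmidt product basis of $|\psi\rangle$. Writing $H=\sum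 H_{kl,mn}|k\rangle\langle l|_A\otimes|m\rangle\langle n|_B$ in that basis and $H_{I,ij}=\mathrm{Im}\,H_{ij,ij}$, the numbers $k_i$ are $k_i=\sum_{j=1}^{d}H_{I,ij}C_j$. Here $|ii\rangle=|i\rangle_A|i\rangle_B$.
   Formalization: The equation sum k_i^2 = 1 is claimed for every maximizer only if the C_i are not all equal (if all are equal the rate vanishes and H = 0 is a maximizer with k = 0); for every state with d >= 2 some maximizer satisfying all three equations is shown to exist. *)

(* Defs.v *)
From mathcomp Require Import all_boot all_order all_algebra.
From mathcomp Require Import complex mxtens.
From mathcomp Require Import all_classical all_reals all_analysis.

Set Implicit Arguments.
Unset Strict Implicit.
Unset Printing Implicit Defensive.

Import Order.TTheory GRing.Theory Num.Theory.

Local Open Scope ring_scope.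
Local Open Scope complex_scope.
Local Open Scope sesquilinear_scope.

(* Functional calculus f(A) of a Hermitian matrix A.  [complex.Re] only changes
   the type of the eigenvalues, which are real for Hermitian A. *)
Definition hermfun (R : realType) (n : nat) (f : R -> R[i]) (A : 'M[R[i]]_n) :
    'M[R[i]]_n :=
  invmx (spectralmx A)
  *m diag_mx (map_mx (fun z : R[i] => f (complex.Re z)) (spectral_diag A))
  *m spectralmx A.

(* exp(- i H t) *)
Definition evolution (R : realType) (n : nat) (H : 'M[R[i]]_n) (t : R) :
    'M[R[i]]_n :=
  hermfun (fun x => cos (x * t) -i* sin (x * t)) H.

(* The library sets ln 0 = 0, which is the convention 0 log 0 = 0 once the
   logarithm is multiplied by rho. *)
Definition vn_entropy (R : realType) (n : nat) (rho : 'M[R[i]]_n) : R :=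
  - complex.Re (\tr (rho *m hermfun (fun x => (ln x)%:C) rho)).

Definition ptraceB (R : realType) (dA dB : nat) (rho : 'M[R[i]]_(dA * dB)) :
    'M[R[i]]_dA :=
  \matrix_(i, i') \sum_(j < dB) rho (mxtens_index (i, j)) (mxtens_index (i', j)).

(* The relative entropy of entanglement of a pure state rho, which is its
   entanglement entropy.  This is the value of the measure on pure states only,
   and it is only used along unitary orbits of a pure state. *)
Definition pure_entanglement (R : realType) (dA dB : nat)
    (rho : 'M[R[i]]_(dA * dB)) : R :=
  vn_entropy (ptraceB rho).

Definition ent_rate (R : realType) (dA dB : nat)
    (psi : 'cV[R[i]]_(dA * dB)) (H : 'M[R[i]]_(dA * dB)) : R :=
  derive1 (fun t : R => pure_entanglement
    (evolution H t *m (psi *m psi ^t*) *m evolution H (- t))) 0.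

(* <u|A|v> *)
Definition braket (R : realType) (n : nat) (u : 'cV[R[i]]_n) (A : 'M[R[i]]_n)
    (v : 'cV[R[i]]_n) : R[i] :=
  (u ^t* *m A *m v) ord0 ord0.

Definition energy_variance (R : realType) (n : nat) (psi : 'cV[R[i]]_n)
    (H : 'M[R[i]]_n) : R :=
  complex.Re (braket psi (H *m H) psi - braket psi H psi ^+ 2).

Definition admissible (R : realType) (n : nat) (psi : 'cV[R[i]]_n)
    (H : 'M[R[i]]_n) : Prop :=
  H \is hermsymmx /\ energy_variance psi H <= 1.

Definition maximizes_rate (R : realType) (dA dB : nat)
    (psi : 'cV[R[i]]_(dA * dB)) (H : 'M[R[i]]_(dA * dB)) : Prop :=
  admissible psi H /\
  forall H' : 'M[R[i]]_(dA * dB), admissible psi H' ->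
    ent_rate psi H' <= ent_rate psi H.

Definition orthonormal_family (R : realType) (n d : nat)
    (a : 'I_d -> 'cV[R[i]]_n) : Prop :=
  forall i j : 'I_d, braket (a i) 1%:M (a j) = (i == j)%:R.

Definition tensor_ket (R : realType) (dA dB : nat) (u : 'cV[R[i]]_dA)
    (v : 'cV[R[i]]_dB) : 'cV[R[i]]_(dA * dB) :=
  u *t v.

Definition schmidt_state (R : realType) (dA dB d : nat) (C : 'I_d -> R)
    (a : 'I_d -> 'cV[R[i]]_dA) (b : 'I_d -> 'cV[R[i]]_dB) :
    'cV[R[i]]_(dA * dB) :=
  \sum_(i < d) (C i)%:C *: tensor_ket (a i) (b i).

(* The coefficient H_{kl,mn} of |k><l| (x) |m><n|: the first pair of indices
   belongs to A and the second one to B. *)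
Definition op_coeff (R : realType) (dA dB d : nat)
    (a : 'I_d -> 'cV[R[i]]_dA) (b : 'I_d -> 'cV[R[i]]_dB)
    (H : 'M[R[i]]_(dA * dB)) (k l m n : 'I_d) : R[i] :=
  braket (tensor_ket (a k) (b m)) H (tensor_ket (a l) (b n)).

Definition kcoef (R : realType) (dA dB d : nat) (C : 'I_d -> R)
    (a : 'I_d -> 'cV[R[i]]_dA) (b : 'I_d -> 'cV[R[i]]_dB)
    (H : 'M[R[i]]_(dA * dB)) (i : 'I_d) : R :=
  \sum_(j < d) complex.Im (op_coeff a b H i j i j) * C j.

(* Main.v *)
(* In the Schmidt basis the rate is -4 sum_i C_i ln(C_i) k_i, where
   sum_i C_i k_i = Im <psi|H|psi> = 0.  No perturbation theory of eigenvalues is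
   needed for this: with s = rho(0) positive definite, Klein's inequality and
   the bound of the relative entropy by the chi-square divergence enclose
   S(rho(t)) between
     - tr (rho ln s) - (tr (rho^2 s^-1) - tr rho)   and
     - tr (rho ln s) - (tr rho - tr s),
   two functions which agree, together with their derivatives, at t = 0.
   If dA > dB, then rho_A is singular and one works with rho_B instead.
   By Bessel's inequality the variance is at least sum_i k_i^2, and every real
   k orthogonal to C, with kappa = sum_i k_i |ii>, is realized with variance
   sum_i k_i^2 by H = i (|kappa><psi| - |psi><kappa|).  It remains to maximize
   a linear form over the unit ball of the hyperplane orthogonal to C, where
   equality in Cauchy-Schwarz gives the Lagrange equations. *)
Require Import Defs.
From mathcomp Require Import all_boot all_order all_algebra.
From mathcomp Require Import complex mxtens.
From mathcomp Require Import all_classical all_reals all_analysis.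
From mathcomp Require Import ring lra.

Set Implicit Arguments.
Unset Strict Implicit.
Unset Printing Implicit Defensive.

Import Order.TTheory GRing.Theory Num.Theory.
Import numFieldNormedType.Exports.

Local Open Scope ring_scope.
Local Open Scope complex_scope.
Local Open Scope sesquilinear_scope.

(** * Functional calculus of Hermitian matrices *)

Lemma conj_complexE (R : realType) (z : R[i]) :
  Num.conj z = complex.Re z -i* complex.Im z.
Proof. by case: z. Qed.

Lemma ReC_sum (R : realType) (I : Type) (r : seq I) (P : pred I)
  (F : I -> R[i]) :
  complex.Re (\sum_(i <- r | P i) F i) = \sum_(i <- r | P i) complex.Re (F i).
Proof. exact: (raddf_sum (@complex.Re R : {additive Rcomplex R -> R})). Qed.

Lemma ImC_sum (R : realType) (I : Type) (r : seq I) (P : pred I)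
  (F : I -> R[i]) :
  complex.Im (\sum_(i <- r | P i) F i) = \sum_(i <- r | P i) complex.Im (F i).
Proof. exact: (raddf_sum (@complex.Im R : {additive Rcomplex R -> R})). Qed.

Lemma ReCD (R : realType) (x y : R[i]) :
  complex.Re (x + y) = complex.Re x + complex.Re y.
Proof. by case: x y => [? ?] [? ?]. Qed.

Lemma ImCD (R : realType) (x y : R[i]) :
  complex.Im (x + y) = complex.Im x + complex.Im y.
Proof. by case: x y => [? ?] [? ?]. Qed.

Lemma ReCM (R : realType) (x y : R[i]) : complex.Re (x * y) =
  complex.Re x * complex.Re y - complex.Im x * complex.Im y.
Proof. by case: x y => [? ?] [? ?]. Qed.

Lemma ImCM (R : realType) (x y : R[i]) : complex.Im (x * y) =
  complex.Re x * complex.Im y + complex.Im x * complex.Re y.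
Proof. by case: x y => [? ?] [? ?]. Qed.

Lemma ReCZ (R : realType) (c : R) (x : R[i]) :
  complex.Re (c%:C * x) = c * complex.Re x.
Proof. by case: x => a b /=; rewrite mul0r subr0. Qed.

Lemma ImCZ (R : realType) (c : R) (x : R[i]) :
  complex.Im (c%:C * x) = c * complex.Im x.
Proof. by case: x => a b /=; rewrite mul0r addr0. Qed.

Lemma hermsymmx_adj (R : realType) (n : nat) (A : 'M[R[i]]_n) :
  A \is hermsymmx = (A^t* == A).
Proof.
rewrite qualifE/=; have -> : (-1) ^+ false = 1 :> R[i] by [].
by rewrite scale1r eq_sym.
Qed.

Lemma ctmxM (R : realType) (m n p : nat) (A : 'M[R[i]]_(m, n))
  (B : 'M[R[i]]_(n, p)) : (A *m B)^t* = B^t* *m A^t*.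
Proof. by rewrite trmx_mul map_mxM. Qed.

Lemma ctmxZ (R : realType) (m n : nat) (c : R[i]) (A : 'M[R[i]]_(m, n)) :
  (c *: A)^t* = Num.conj c *: A^t*.
Proof. by apply/matrixP => i j; rewrite !mxE rmorphM. Qed.

Lemma ctmxB (R : realType) (m n : nat) (A B : 'M[R[i]]_(m, n)) :
  (A - B)^t* = A^t* - B^t*.
Proof. by apply/matrixP => i j; rewrite !mxE rmorphB. Qed.

Lemma conj_i (R : realType) : Num.conj 'i%C = - 'i%C :> R[i].
Proof.
by rewrite conj_complexE; apply/eqP; rewrite eq_complex /= oppr0 !eqxx.
Qed.

Lemma conj_real (R : realType) (x : R) : Num.conj x%:C = x%:C :> R[i].
Proof. by rewrite conj_complexE /= oppr0. Qed.

Lemma gram_hermsymmx (R : realType) (m n : nat) (A : 'M[R[i]]_(m, n)) :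
  A *m A^t* \is hermsymmx.
Proof. by rewrite hermsymmx_adj ctmxM trmxCK. Qed.

Section Hermfun.
Variable R : realType.
Implicit Types m n : nat.

Lemma hermfunE n (f : R -> R[i]) (A : 'M[R[i]]_n) :
  hermfun f A = (spectralmx A)^t*
    *m diag_mx (map_mx (fun z => f (complex.Re z)) (spectral_diag A))
    *m spectralmx A.
Proof. by rewrite /hermfun (invmx_unitary (spectral_unitarymx A)). Qed.

(** With N = P X Q^-1 the relation reads p_i N_ij = N_ij q_j, so N_ij can be nonzero only where p_i
    = q_j, and there f takes the same value on both. A rectangular [X] is allowed, so that M M^* can
    be compared with M^* M. *)
Lemma conj_diag_intertwine m n (f : R[i] -> R[i]) (P : 'M[R[i]]_m)
  (Q : 'M[R[i]]_n) (p : 'rV_m) (q : 'rV_n) (X : 'M[R[i]]_(m, n)) :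
  P \in unitmx -> Q \in unitmx ->
  invmx P *m diag_mx p *m P *m X = X *m (invmx Q *m diag_mx q *m Q) ->
  invmx P *m diag_mx (map_mx f p) *m P *m X =
  X *m (invmx Q *m diag_mx (map_mx f q) *m Q).
Proof.
move=> uP uQ eqX.
have [N NE] : exists N, N = P *m X *m invmx Q by exists (P *m X *m invmx Q).
have XE : X = invmx P *m N *m Q by rewrite NE -!mulmxA mulVmx// mulmx1 mulKmx.
have eqN : diag_mx p *m N = N *m diag_mx q.
  have := congr1 (fun Z => P *m Z *m invmx Q) eqX.
  by rewrite NE !mulmxA (mulmxV uP) mul1mx (mulmxK uQ).
have {eqN} eqN : diag_mx (map_mx f p) *m N = N *m diag_mx (map_mx f q).
  rewrite !mul_diag_mx !mul_mx_diag in eqN; rewrite mul_diag_mx mul_mx_diag.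
  apply/matrixP => i j.
  move/matrixP/(_ i j): eqN; rewrite ![in X in X -> _]mxE => eqN.
  rewrite ![in LHS]mxE ![in RHS]mxE.
  have [-> | N0] := eqVneq (N i j) 0; first by rewrite mulr0 mul0r.
  rewrite mulrC; congr (_ * f _).
  by apply: (mulIf N0); rewrite eqN mulrC.
rewrite XE !mulmxA (mulmxK uP) (mulmxK uQ); congr (_ *m _).
by rewrite -!mulmxA -eqN.
Qed.

Lemma spectralE n (A : 'M[R[i]]_n) : A \is hermsymmx ->
  A = invmx (spectralmx A) *m diag_mx (spectral_diag A) *m spectralmx A.
Proof. by move=> /hermitian_normalmx /orthomx_spectralP {1}->. Qed.

Lemma hermfun_intertwine m n (f : R -> R[i]) (A : 'M[R[i]]_m) (B : 'M[R[i]]_n)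
  (X : 'M[R[i]]_(m, n)) : A \is hermsymmx -> B \is hermsymmx ->
  A *m X = X *m B -> hermfun f A *m X = X *m hermfun f B.
Proof.
move=> hA hB eqX.
apply: (@conj_diag_intertwine _ _ (fun z => f (complex.Re z))).
- exact: spectral_unit.
- exact: spectral_unit.
- by rewrite -!spectralE.
Qed.

(** This frees the functional calculus from the eigenbasis chosen by [spectralmx]: the logarithm of
    a reduced state can be read off in the Schmidt basis. *)
Lemma hermfun_diagonalized m n (f : R -> R[i]) (A : 'M[R[i]]_m) (c : 'rV_n)
  (X : 'M[R[i]]_(m, n)) : A \is hermsymmx -> A *m X = X *m diag_mx c ->
  hermfun f A *m X = X *m diag_mx (map_mx (fun z => f (complex.Re z)) c).
Proof.
move=> hA eqX.
have := @conj_diag_intertwine _ _ (fun z => f (complex.Re z)) _ 1%:M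
  (spectral_diag A) c X (spectral_unit A) (unitmx1 _ _).
rewrite invmx1 !mul1mx !mulmx1; apply.
by rewrite -spectralE.
Qed.

Lemma conj_diagM n (P : 'M[R[i]]_n) (p q : 'rV_n) : P \in unitmx ->
  invmx P *m diag_mx p *m P *m (invmx P *m diag_mx q *m P) =
  invmx P *m diag_mx (\row_i (p 0 i * q 0 i)) *m P.
Proof.
move=> uP; rewrite !mulmxA (mulmxK uP) -(mulmxA (invmx P)).
by rewrite mulmx_diag.
Qed.

Lemma hermfunM n (f g : R -> R[i]) (A : 'M[R[i]]_n) :
  hermfun f A *m hermfun g A = hermfun (fun x => f x * g x) A.
Proof.
rewrite /hermfun (conj_diagM _ _ (spectral_unit A)).
suff -> : map_mx (fun z => f (complex.Re z) * g (complex.Re z))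
    (spectral_diag A) =
    \row_i (map_mx (fun z => f (complex.Re z)) (spectral_diag A) 0 i
            * map_mx (fun z => g (complex.Re z)) (spectral_diag A) 0 i).
  by [].
by apply/rowP => i; rewrite !mxE.
Qed.

Lemma hermfun1 n (A : 'M[R[i]]_n) : hermfun (fun=> 1) A = 1%:M.
Proof.
rewrite /hermfun (_ : map_mx _ _ = const_mx 1); last first.
  by apply/rowP => i; rewrite !mxE.
by rewrite diag_const_mx mulmx1 mulVmx ?spectral_unit.
Qed.

Lemma hermfun_id n (A : 'M[R[i]]_n) : A \is hermsymmx ->
  hermfun (fun x => x%:C) A = A.
Proof.
move=> hA; rewrite /hermfun (_ : map_mx _ _ = spectral_diag A).
  by rewrite -spectralE.
apply/rowP => i; rewrite mxE; apply: RRe_real.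
by have /mxOverP := hermitian_spectral_diag_real hA.
Qed.

Definition eigval n (A : 'M[R[i]]_n) (i : 'I_n) : R :=
  complex.Re (spectral_diag A 0 i).

(** The transition probability between the i-th eigenvector of [A] and the j-th of [B]. With these
    weights the trace of f(A) g(B) is a double sum over the two spectra, so scalar inequalities
    suffice. *)
Definition overlap n (A B : 'M[R[i]]_n) (i j : 'I_n) : R :=
  complex.Re (`|(spectralmx A *m (spectralmx B)^t*) i j| ^+ 2).

Lemma overlap_ge0 n (A B : 'M[R[i]]_n) i j : 0 <= overlap A B i j.
Proof.
rewrite /overlap; have : 0 <= `|(spectralmx A *m (spectralmx B)^t*) i j| ^+ 2.
  by rewrite exprn_ge0.
by rewrite lecE => /andP[].
Qed.

Lemma tr_diag_conj m n (p : 'rV[R[i]]_m) (q : 'rV_n) (W : 'M[R[i]]_(m, n)) :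
  \tr (diag_mx p *m (W *m (diag_mx q *m W^t*))) =
  \sum_i \sum_j p 0 i * q 0 j * `|W i j| ^+ 2.
Proof.
rewrite !mul_diag_mx /mxtrace; apply: eq_bigr => i _; rewrite !mxE mulr_sumr.
by apply: eq_bigr => j _; rewrite !mxE normCK -mulrA (mulrCA (W i j)).
Qed.

Lemma Re_tr_hermfunM n (f g : R -> R) (A B : 'M[R[i]]_n) :
  complex.Re (\tr (hermfun (fun x => (f x)%:C) A
                *m hermfun (fun x => (g x)%:C) B)) =
  \sum_i \sum_j f (eigval A i) * g (eigval B j) * overlap A B i j.
Proof.
rewrite !hermfunE -!mulmxA mxtrace_mulC -!mulmxA.
have -> : spectralmx B *m (spectralmx A)^t* =
    (spectralmx A *m (spectralmx B)^t*)^t*.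
  by rewrite ctmxM trmxCK.
rewrite (mulmxA (spectralmx A)) tr_diag_conj ReC_sum.
apply: eq_bigr => i _; rewrite ReC_sum; apply: eq_bigr => j _.
by rewrite (mxE _ _ 0 i) (mxE _ _ 0 j) -mulrA 2!ReCZ mulrA.
Qed.

End Hermfun.

(** * Relative entropy bounds *)

Lemma ln_le_subr1 (R : realType) (x : R) : 0 < x -> ln x <= x - 1.
Proof.
move=> x0; have := @le_ln1Dx R (x - 1).
by rewrite (addrC 1) subrK; apply; rewrite ltrBrDl addrN.
Qed.

(** For p > 0 this is p times ln (q/p) <= q/p - 1; it is the scalar form of Klein's inequality. *)
Lemma mul_ln_ge (R : realType) (p q : R) : 0 <= p -> 0 < q ->
  p - q <= p * ln p - p * ln q.
Proof.
rewrite le_eqVlt => /predU1P[<- q0|p0 q0]; first by rewrite !mul0r; lra.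
have := ln_le_subr1 (divr_gt0 q0 p0); rewrite ln_div ?posrE// => h.
have : p * (ln q - ln p) <= p * (q / p - 1) by rewrite ler_pM2l.
have -> : p * (q / p - 1) = q - p by field; rewrite gt_eqF.
lra.
Qed.

(** The same logarithm bound, now applied to p/q, gives the scalar chi-square estimate. *)
Lemma mul_ln_le (R : realType) (p q : R) : 0 <= p -> 0 < q ->
  p * ln p - p * ln q <= p ^+ 2 / q - p.
Proof.
rewrite le_eqVlt => /predU1P[<- q0|p0 q0].
  by rewrite expr0n/= !mul0r; lra.
have := ln_le_subr1 (divr_gt0 p0 q0); rewrite ln_div ?posrE// => h.
have : p * (ln p - ln q) <= p * (p / q - 1) by rewrite ler_pM2l.
have -> : p * (p / q - 1) = p ^+ 2 / q - p by field; rewrite gt_eqF.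
lra.
Qed.

Section Klein.
Variables (R : realType) (n : nat).
Implicit Types A B : 'M[R[i]]_n.

Let lnC (x : R) := (ln x)%:C.
Let invC (x : R) := (x^-1)%:C.

(** Inserting the constant function 1 of [B] spreads a trace involving [A] alone over the same
    double sum as the mixed traces, which can then be compared term by term. *)
Lemma vn_entropy_overlap A B : A \is hermsymmx ->
  vn_entropy A =
  - \sum_i \sum_j eigval A i * ln (eigval A i) * overlap A B i j.
Proof.
move=> hA; rewrite /vn_entropy; congr (- _).
rewrite -[X in X *m _](hermfun_id hA) hermfunM.
rewrite -[hermfun _ A]mulmx1 -(hermfun1 B).
have -> : hermfun (fun x : R => x%:C * (ln x)%:C) A =
          hermfun (fun x : R => (x * ln x)%:C) A.
  by congr hermfun; apply/funext => x; rewrite rmorphM.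
rewrite (Re_tr_hermfunM (fun x => x * ln x) (fun=> 1)).
by apply: eq_bigr => i _; apply: eq_bigr => j _; rewrite mulr1.
Qed.

Lemma Re_tr_overlapl A B : A \is hermsymmx ->
  complex.Re (\tr A) = \sum_i \sum_j eigval A i * overlap A B i j.
Proof.
move=> hA; rewrite -[in LHS](hermfun_id hA) -[hermfun _ A]mulmx1 -(hermfun1 B).
rewrite (Re_tr_hermfunM id (fun=> 1)).
by apply: eq_bigr => i _; apply: eq_bigr => j _; rewrite mulr1.
Qed.

Lemma Re_tr_overlapr A B : B \is hermsymmx ->
  complex.Re (\tr B) = \sum_i \sum_j eigval B j * overlap A B i j.
Proof.
move=> hB; rewrite -[in LHS](hermfun_id hB) -[hermfun _ B]mul1mx -(hermfun1 A).
rewrite (Re_tr_hermfunM (fun=> 1) id).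
by apply: eq_bigr => i _; apply: eq_bigr => j _; rewrite mul1r.
Qed.

Lemma Re_tr_mul_ln A B : A \is hermsymmx ->
  complex.Re (\tr (A *m hermfun lnC B)) =
  \sum_i \sum_j eigval A i * ln (eigval B j) * overlap A B i j.
Proof.
by move=> hA; rewrite -[in LHS](hermfun_id hA) (Re_tr_hermfunM id (@ln R)).
Qed.

Lemma Re_tr_sqr_inv A B : A \is hermsymmx ->
  complex.Re (\tr (A *m A *m hermfun invC B)) =
  \sum_i \sum_j eigval A i ^+ 2 / eigval B j * overlap A B i j.
Proof.
move=> hA; rewrite -[in LHS](hermfun_id hA) hermfunM.
have -> : hermfun (fun x : R => x%:C * x%:C) A =
          hermfun (fun x : R => (x ^+ 2)%:C) A.
  by congr hermfun; apply/funext => x; rewrite -rmorphM.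
by rewrite (Re_tr_hermfunM (fun x => x ^+ 2) (@GRing.inv R)).
Qed.

(* Klein's inequality *)
Lemma vn_entropy_le A B : A \is hermsymmx -> B \is hermsymmx ->
  (forall i, 0 <= eigval A i) -> (forall i, 0 < eigval B i) ->
  vn_entropy A <=
  - complex.Re (\tr (A *m hermfun lnC B))
  - (complex.Re (\tr A) - complex.Re (\tr B)).
Proof.
move=> hA hB A0 B0; rewrite (vn_entropy_overlap B hA) (Re_tr_mul_ln B hA).
rewrite (Re_tr_overlapl B hA) (Re_tr_overlapr A hB).
rewrite ?opprB -!sumrN -!big_split/=; apply: ler_sum => i _.
rewrite ?opprB -!sumrN -!big_split/=; apply: ler_sum => j _.
have := ler_wpM2r (overlap_ge0 A B i j) (mul_ln_ge (A0 i) (B0 j)).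
lra.
Qed.

(* The quantum relative entropy is at most the chi-square divergence. *)
Lemma vn_entropy_ge A B : A \is hermsymmx ->
  (forall i, 0 <= eigval A i) -> (forall i, 0 < eigval B i) ->
  - complex.Re (\tr (A *m hermfun lnC B))
  - (complex.Re (\tr (A *m A *m hermfun invC B)) - complex.Re (\tr A))
  <= vn_entropy A.
Proof.
move=> hA A0 B0.
have eqs a b c d a' b' c' d' : a = a' -> b = b' -> c = c' -> d = d' ->
  - b' - (c' - d') <= a' -> - b - (c - d) <= a :> R by move=> -> -> -> ->.
apply: (eqs _ _ _ _ _ _ _ _ (vn_entropy_overlap B hA) (Re_tr_mul_ln B hA)
  (Re_tr_sqr_inv B hA) (Re_tr_overlapl B hA)).
rewrite ?opprB -!sumrN -!big_split/=; apply: ler_sum => i _.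
rewrite ?opprB -!sumrN -!big_split/=; apply: ler_sum => j _.
have := ler_wpM2r (overlap_ge0 A B i j) (mul_ln_le (A0 i) (B0 j)).
lra.
Qed.

End Klein.

(** * Differentiation of complex matrices *)

(** The three functions agree at [x], so the difference quotient of [f] lies between those of [g]
    and [h], both of which tend to [c]. *)
Lemma squeeze_is_derive (R : realType) (x c : R) (f g h : R -> R) :
  (forall t, g t <= f t <= h t) -> g x = f x -> h x = f x ->
  is_derive x 1 g c -> is_derive x 1 h c -> is_derive x 1 f c.
Proof.
move=> gfh gx hx [dg g'] [dh h'].
pose q (k : R -> R) (e : R) := e^-1 *: ((k \o shift x) (e *: 1) - k x).
have cvg_q k : derivable k x 1 -> 'D_1 k x = c ->
    (q k e @[e --> 0^'] --> c)%classic.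
  by move=> /cvg_ex[l kl] <-; rewrite /derive (cvg_lim _ kl).
have cvg_f : (q f e @[e --> 0^'] --> c)%classic.
  apply/cvgrPdist_le => eps eps0.
  move: (cvg_q _ dg g') => /cvgrPdist_le/(_ _ eps0) near_g.
  move: (cvg_q _ dh h') => /cvgrPdist_le/(_ _ eps0) near_h.
  near=> e.
  have /[!ler_norml]/andP[g1 g2] : `|c - q g e| <= eps.
    by near: e; exact: near_g.
  have /[!ler_norml]/andP[h1 h2] : `|c - q h e| <= eps.
    by near: e; exact: near_h.
  have e0 : e != 0 by near: e; exact: nbhs_dnbhs_neq.
  have /andP[gf fh] := gfh (e *: 1 + x).
  move: g1 g2 h1 h2; rewrite /q /= gx hx /GRing.scale/=.
  set a := g _ in gf *; set b := f _ in gf fh *; set d := h _ in fh *.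
  move=> g1 g2 h1 h2.
  (* Dividing by a negative increment reverses the order of the three quotients. *)
  have [en|ep] := ltP e 0.
    have : e^-1 * (b - f x) <= e^-1 * (a - f x).
      by rewrite ler_nM2l ?invr_lt0// lerD2r.
    have : e^-1 * (d - f x) <= e^-1 * (b - f x).
      by rewrite ler_nM2l ?invr_lt0// lerD2r.
    by move=> ? ?; apply/andP; split; lra.
  have {}ep : 0 < e by rewrite lt_def e0.
  have : e^-1 * (a - f x) <= e^-1 * (b - f x).
    by rewrite ler_pM2l ?invr_gt0// lerD2r.
  have : e^-1 * (b - f x) <= e^-1 * (d - f x).
    by rewrite ler_pM2l ?invr_gt0// lerD2r.
  by move=> ? ?; apply/andP; split; lra.
split; first by apply/cvg_ex; exists c.
exact: cvg_lim.
Unshelve. all: by end_near. Qed.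

Section Cderive.
Variables (R : realType) (x : R).
Implicit Types m n p : nat.

(** Working in real coordinates treats conjugation, which is not complex linear, on the same footing
    as sums and products. *)
Definition cderive (f : R -> R[i]) (l : R[i]) : Prop :=
  is_derive x 1 (fun t => complex.Re (f t)) (complex.Re l) /\
  is_derive x 1 (fun t => complex.Im (f t)) (complex.Im l).

Lemma cderive_cst (c : R[i]) : cderive (fun=> c) 0.
Proof. by split; exact: is_derive_cst. Qed.

Lemma cderiveD f g k l : cderive f k -> cderive g l ->
  cderive (fun t => f t + g t) (k + l).
Proof.
move=> [f1 f2] [g1 g2]; split.
- rewrite (_ : (fun t => complex.Re (f t + g t)) =
    (fun t => complex.Re (f t)) + (fun t => complex.Re (g t)))%R.
    by rewrite ReCD; exact: is_deriveD.
  by apply/funext => t; rewrite ReCD.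
- rewrite (_ : (fun t => complex.Im (f t + g t)) =
    (fun t => complex.Im (f t)) + (fun t => complex.Im (g t)))%R.
    rewrite ImCD; exact: is_deriveD.
  by apply/funext => t; rewrite ImCD.
Qed.

Lemma cderiveM f g k l : cderive f k -> cderive g l ->
  cderive (fun t => f t * g t) (k * g x + f x * l).
Proof.
move=> [f1 f2] [g1 g2]; split.
- rewrite (_ : (fun t => complex.Re (f t * g t)) =
    (fun t => complex.Re (f t)) * (fun t => complex.Re (g t))
    - (fun t => complex.Im (f t)) * (fun t => complex.Im (g t)))%R.
    apply: (is_derive_eq (is_deriveB (is_deriveM f1 g1) (is_deriveM f2 g2))).
    rewrite /GRing.scale/=.
    by rewrite ReCD !ReCM; ring.
  by apply/funext => t; rewrite ReCM.
- rewrite (_ : (fun t => complex.Im (f t * g t)) =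
    (fun t => complex.Re (f t)) * (fun t => complex.Im (g t))
    + (fun t => complex.Im (f t)) * (fun t => complex.Re (g t)))%R.
    apply: (is_derive_eq (is_deriveD (is_deriveM f1 g2) (is_deriveM f2 g1))).
    rewrite /GRing.scale/=.
    by rewrite ImCD !ImCM; ring.
  by apply/funext => t; rewrite ImCM.
Qed.

Lemma cderive_conj f k : cderive f k ->
  cderive (fun t => Num.conj (f t)) (Num.conj k).
Proof.
move=> [f1 f2]; split.
- rewrite (_ : (fun t => complex.Re (Num.conj (f t))) =
    (fun t => complex.Re (f t))).
    by rewrite conj_complexE.
  by apply/funext => t; rewrite conj_complexE.
- rewrite (_ : (fun t => complex.Im (Num.conj (f t))) =
    - (fun t => complex.Im (f t))).
    by rewrite conj_complexE /=; exact: is_deriveN.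
  by apply/funext => t; rewrite conj_complexE.
Qed.

Lemma cderive_sum n (f : 'I_n -> R -> R[i]) (k : 'I_n -> R[i]) :
  (forall i, cderive (f i) (k i)) ->
  cderive (fun t => \sum_i f i t) (\sum_i k i).
Proof.
elim: n f k => [|n IHn] f k fk.
  rewrite big_ord0 (_ : (fun t => _) = (fun=> 0)); first exact: cderive_cst.
  by apply/funext => t; rewrite big_ord0.
rewrite big_ord_recl (_ : (fun t => _) =
  (fun t => f ord0 t + \sum_(i < n) f (lift ord0 i) t)).
  by apply: cderiveD => //; apply: IHn.
by apply/funext => t; rewrite big_ord_recl.
Qed.

Definition mxderive m n (F : R -> 'M[R[i]]_(m, n)) (L : 'M[R[i]]_(m, n)) :
    Prop :=
  forall i j, cderive (fun t => F t i j) (L i j).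

Lemma mxderive_cst m n (A : 'M[R[i]]_(m, n)) : mxderive (fun=> A) 0.
Proof. by move=> i j; rewrite mxE; exact: cderive_cst. Qed.

Lemma mxderiveM m n p (F : R -> 'M[R[i]]_(m, n)) (G : R -> 'M[R[i]]_(n, p))
  K L : mxderive F K -> mxderive G L ->
  mxderive (fun t => F t *m G t) (K *m G x + F x *m L).
Proof.
move=> FK GL i j; rewrite !mxE -big_split/=.
rewrite (_ : (fun t => _) = (fun t => \sum_k F t i k * G t k j)).
  by apply: cderive_sum => k; exact: cderiveM.
by apply/funext => t; rewrite mxE.
Qed.

Lemma mxderiveMr m n p (F : R -> 'M[R[i]]_(m, n)) (A : 'M[R[i]]_(n, p)) K :
  mxderive F K -> mxderive (fun t => F t *m A) (K *m A).
Proof.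
by move=> FK; have := mxderiveM FK (mxderive_cst A); rewrite mulmx0 addr0.
Qed.

Lemma mxderiveMl m n p (A : 'M[R[i]]_(m, n)) (F : R -> 'M[R[i]]_(n, p)) K :
  mxderive F K -> mxderive (fun t => A *m F t) (A *m K).
Proof.
by move=> FK; have := mxderiveM (mxderive_cst A) FK; rewrite mul0mx add0r.
Qed.

Lemma mxderive_adj m n (F : R -> 'M[R[i]]_(m, n)) K : mxderive F K ->
  mxderive (fun t => (F t)^t*) (K^t*).
Proof.
move=> FK i j; rewrite !mxE (_ : (fun t => _) = (fun t => Num.conj (F t j i))).
  exact: cderive_conj.
by apply/funext => t; rewrite !mxE.
Qed.

Lemma is_derive_Re_tr n (F : R -> 'M[R[i]]_n) K : mxderive F K ->
  is_derive x 1 (fun t => complex.Re (\tr (F t))) (complex.Re (\tr K)).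
Proof. by move=> FK; have [] := cderive_sum (fun i => FK i i). Qed.

End Cderive.

(** * Derivative of the entropy at a positive definite matrix *)

Section EntropyDerivative.
Variable R : realType.
Implicit Types m n : nat.

Lemma eq_hermfun n (f g : R -> R[i]) (A : 'M[R[i]]_n) :
  (forall i, f (eigval A i) = g (eigval A i)) -> hermfun f A = hermfun g A.
Proof.
move=> fg; suff e : map_mx (fun z => f (complex.Re z)) (spectral_diag A) =
    map_mx (fun z => g (complex.Re z)) (spectral_diag A).
  by rewrite /hermfun e.
by apply/rowP => i; rewrite !mxE; exact: fg.
Qed.

Lemma mul_hermfun_inv n (A : 'M[R[i]]_n) : A \is hermsymmx ->
  (forall i, 0 < eigval A i) -> A *m hermfun (fun x => (x^-1)%:C) A = 1%:M.
Proof.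
move=> hA A0; rewrite -[X in X *m _](hermfun_id hA) hermfunM -(hermfun1 A).
by apply: eq_hermfun => i; rewrite -rmorphM divff// gt_eqF.
Qed.

Lemma hermfun_inv_mul n (A : 'M[R[i]]_n) : A \is hermsymmx ->
  (forall i, 0 < eigval A i) -> hermfun (fun x => (x^-1)%:C) A *m A = 1%:M.
Proof. by move=> hA A0; apply: mulmx1C; exact: mul_hermfun_inv. Qed.

Lemma conj_diag_invK n (P : 'M[R[i]]_n) (D : 'M[R[i]]_n) : P \in unitmx ->
  P *m (invmx P *m D *m P) *m invmx P = D.
Proof. by move=> uP; rewrite !mulmxA (mulmxV uP) mul1mx (mulmxK uP). Qed.

Lemma spectral_diagE n (A : 'M[R[i]]_n) : A \is hermsymmx ->
  diag_mx (spectral_diag A) = spectralmx A *m A *m (spectralmx A)^t*.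
Proof.
move=> hA; have := conj_diag_invK (diag_mx (spectral_diag A)) (spectral_unit A).
by rewrite -(spectralE hA) (invmx_unitary (spectral_unitarymx A)).
Qed.

(** In the eigenbasis P the eigenvalue is a diagonal entry of (P M)(P M)^*, hence a sum of squared
    moduli. *)
Lemma eigval_gram_ge0 n m (M : 'M[R[i]]_(n, m)) i : 0 <= eigval (M *m M^t*) i.
Proof.
set A := M *m M^t*; have hA : A \is hermsymmx by exact: gram_hermsymmx.
suff : 0 <= spectral_diag A 0 i by rewrite lecE => /andP[].
have -> : spectral_diag A 0 i = diag_mx (spectral_diag A) i i.
  by rewrite mxE eqxx mulr1n.
rewrite (spectral_diagE hA) /A !mulmxA -(mulmxA _ (M^t*)) -ctmxM mxE.
by apply: sumr_ge0 => j _; rewrite !mxE mul_conjC_ge0.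
Qed.

(* For a positive definite [r x], both sides of the sandwich of [vn_entropy_ge]
   and [vn_entropy_le] touch the entropy at [x] and have the same derivative. *)
Lemma is_derive_vn_entropy n (r : R -> 'M[R[i]]_n) (r' : 'M[R[i]]_n) (x : R) :
  (forall t, r t \is hermsymmx) -> (forall t i, 0 <= eigval (r t) i) ->
  (forall i, 0 < eigval (r x) i) -> mxderive x r r' ->
  is_derive x 1 (fun t => vn_entropy (r t))
    (- complex.Re (\tr (r' *m hermfun (fun y => (ln y)%:C) (r x)))
     - complex.Re (\tr r')).
Proof.
move=> hr r0 s0 dr; have hs := hr x.
set L := hermfun _ (r x).
have [S SE] : exists S, S = hermfun (fun y : R => (y^-1)%:C) (r x) by eexists.
have sS : r x *m S = 1%:M by rewrite SE mul_hermfun_inv.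
have Ss : S *m r x = 1%:M by rewrite SE hermfun_inv_mul.
have dL := is_derive_Re_tr (mxderiveMr L dr).
have dtr := is_derive_Re_tr dr.
have dS := is_derive_Re_tr (mxderiveMr S (mxderiveM dr dr)).
pose l := (fun t => - complex.Re (\tr (r t *m L))
    - (complex.Re (\tr (r t *m r t *m S)) - complex.Re (\tr (r t)))).
pose u := (fun t => - complex.Re (\tr (r t *m L))
    - (complex.Re (\tr (r t)) - complex.Re (\tr (r x)))).
have lfu t : l t <= vn_entropy (r t) <= u t.
  apply/andP; split.
    by rewrite /l SE; exact: (vn_entropy_ge (hr t) (r0 t) s0).
  exact: (vn_entropy_le (hr t) hs (r0 t) s0).
apply: (squeeze_is_derive lfu).
- by rewrite /l -mulmxA sS mulmx1 subrr subr0.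
- by rewrite /u subrr subr0.
(* At [x] the quadratic term tr (r^2 S) has derivative 2 tr r', because [S] inverts [r x];
   subtracting tr r' leaves one copy, as for the upper bound. *)
- apply: (is_derive_eq (is_deriveB (is_deriveN dL) (is_deriveB dS dtr))).
  rewrite mulmxDl -(mulmxA r') sS mulmx1.
  have -> : \tr (r' + r x *m r' *m S) = \tr r' + \tr r'.
    by rewrite mxtraceD (mxtrace_mulC (r x *m r')) mulmxA Ss mul1mx.
  by rewrite ReCD addrK.
- apply: (is_derive_eq (is_deriveB (is_deriveN dL)
    (is_deriveB dtr (is_derive_cst (complex.Re (\tr (r x))) x 1)))).
  by rewrite subr0.
Qed.

End EntropyDerivative.

(** * Derivative of the entropy at a Schmidt form *)

Section SchmidtForm.
Variable R : realType.
Implicit Types m n d : nat.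

Definition real_diag d (C : 'I_d -> R) : 'M[R[i]]_d :=
  diag_mx (\row_i (C i)%:C).

Lemma real_diag_adj d (C : 'I_d -> R) : (real_diag C)^t* = real_diag C.
Proof.
apply/matrixP => i j; rewrite !mxE [j == i]eq_sym.
case: eqVneq => [->|_]; last by rewrite !mulr0n rmorph0.
by rewrite !mulr1n conj_complexE /= oppr0.
Qed.

Lemma real_diagM d (C C' : 'I_d -> R) :
  real_diag C *m real_diag C' = real_diag (fun i => C i * C' i).
Proof.
rewrite mulmx_diag; congr diag_mx; apply/rowP => i.
by rewrite !mxE -rmorphM.
Qed.

(** [M] intertwines M M^* with M^* M, hence also their logarithms, and cyclicity of the trace does
    the rest. This permits a passage to the smaller marginal (up to transposition). *)
Lemma vn_entropy_gramC n m (M : 'M[R[i]]_(n, m)) :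
  vn_entropy (M *m M^t*) = vn_entropy (M^t* *m M).
Proof.
have h : M^t* *m M \is hermsymmx by rewrite hermsymmx_adj ctmxM trmxCK.
rewrite /vn_entropy; congr (- complex.Re _).
rewrite mxtrace_mulC mulmxA.
rewrite (hermfun_intertwine _ (gram_hermsymmx M) h); last by rewrite mulmxA.
by rewrite -mulmxA mxtrace_mulC -mulmxA mxtrace_mulC.
Qed.

(** The change of basis N between the two diagonalizations is unitary, so its row i has a nonzero
    entry N_ij, which forces the two eigenvalues to coincide. This transfers positivity of the C_i^2
    to [eigval]. *)
Lemma eigval_unitary_diag n (A U : 'M[R[i]]_n) (q : 'I_n -> R) i :
  A \is hermsymmx -> U^t* *m U = 1%:M -> A *m U = U *m real_diag q ->
  exists j, eigval A i = q j.
Proof.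
move=> hA hU AU; pose N := spectralmx A *m U.
have hU' := mulmx1C hU.
have N1 : N *m N^t* = 1%:M.
  rewrite /N ctmxM mulmxA -(mulmxA _ U) hU' mulmx1.
  exact/unitarymxP/spectral_unitarymx.
have DN : diag_mx (spectral_diag A) *m N = N *m real_diag q.
  rewrite (spectral_diagE hA) /N -!mulmxA -AU.
  congr (_ *m _); rewrite !mulmxA -(mulmxA A); congr (_ *m _).
  rewrite -[RHS]mulmx1; congr (_ *m _); apply: mulmx1C.
  exact/unitarymxP/spectral_unitarymx.
have [j Nij] : exists j, N i j != 0.
  apply/existsP; rewrite -negb_forall; apply/negP => /forallP N0.
  have := congr1 (fun Z : 'M[R[i]]_n => Z i i) N1.
  rewrite !mxE eqxx big1 => [/eqP|j _]; first by rewrite eq_sym oner_eq0.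
  by have /eqP -> := N0 j; rewrite mul0r.
exists j; move: DN Nij; rewrite mul_diag_mx mul_mx_diag => /matrixP/(_ i j).
by rewrite !mxE mulrC => /[swap] /mulfI /[apply]; rewrite /eigval => ->.
Qed.

(** As [U] is square, M M^* = U C^2 U^* is positive definite at [x], with logarithm diagonal in [U].
    With G = U^* M' V the derivative becomes G C + C G^*, whose diagonal has real part 2 C_i Re
    G_ii. Pairing it with 2 ln C_i gives the logarithmic term, and its trace gives the other one. *)
Lemma is_derive_vn_entropy_square n m (C : 'I_n -> R) (U : 'M[R[i]]_n)
    (V : 'M[R[i]]_(m, n)) (M : R -> 'M[R[i]]_(n, m)) (M' : 'M[R[i]]_(n, m))
    (x : R) :
  (forall i, 0 < C i) -> U^t* *m U = 1%:M -> V^t* *m V = 1%:M ->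
  M x = U *m real_diag C *m V^t* -> mxderive x M M' ->
  is_derive x 1 (fun t => vn_entropy (M t *m (M t)^t*))
    (- \sum_i (4 * (C i * ln (C i)) + 2 * C i)
         * complex.Re ((U^t* *m M' *m V) i i)).
Proof.
move=> C0 hU hV Mx dM; have hU' := mulmx1C hU.
have MU : (M x)^t* *m U = V *m real_diag C.
  by rewrite Mx !ctmxM trmxCK real_diag_adj -!mulmxA hU mulmx1.
have sU : M x *m (M x)^t* *m U = U *m real_diag (fun i => C i ^+ 2).
  rewrite -mulmxA MU Mx -!mulmxA (mulmxA (V^t*)) hV mul1mx real_diagM.
  by congr (U *m real_diag _); apply/funext => i; rewrite expr2.
have hs := gram_hermsymmx (M x).
have s0 i : 0 < eigval (M x *m (M x)^t*) i.
  have [j ->] := eigval_unitary_diag i hs hU sU.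
  by rewrite exprn_gt0.
have dr := mxderiveM dM (mxderive_adj dM).
apply: (is_derive_eq (is_derive_vn_entropy (fun t => gram_hermsymmx (M t))
  (fun t => eigval_gram_ge0 (M t)) s0 dr)).
set L := hermfun _ _; set r' := _ *m _ + _ *m _.
have LU : L *m U = U *m real_diag (fun i => 2 * ln (C i)).
  rewrite /L (hermfun_diagonalized _ hs sU); congr (_ *m diag_mx _).
  apply/rowP => i; rewrite !mxE; congr (_%:C).
  by rewrite lnXn// mulr_natl.
set G := U^t* *m M' *m V.
have rU : U^t* *m r' *m U = G *m real_diag C + real_diag C *m G^t*.
  rewrite /r' mulmxDr mulmxDl -!mulmxA MU /G -!mulmxA; congr (_ + _).
  have -> : M x = ((M x)^t*)^t* by rewrite trmxCK.
  rewrite !mulmxA -ctmxM MU !ctmxM real_diag_adj.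
  by rewrite trmxCK !mulmxA.
have tr_r' : \tr r' = \tr (U^t* *m r' *m U).
  by rewrite mxtrace_mulC mulmxA hU' mul1mx.
have tr_r'L : \tr (r' *m L) =
    \tr (U^t* *m r' *m U *m real_diag (fun i => 2 * ln (C i))).
  rewrite -[in RHS]mulmxA -LU [in RHS]mulmxA [RHS]mxtrace_mulC.
  by rewrite !mulmxA hU' mul1mx.
rewrite tr_r' tr_r'L rU mul_mx_diag /mxtrace !ReC_sum -!sumrN -big_split/=.
apply: eq_bigr => i _.
rewrite mul_mx_diag mul_diag_mx !mxE conj_complexE.
case: (\sum_j _) => g1 g2 /=; ring.
Qed.

(** If n <= m, [U] is square. Otherwise [V] is, and the square case is applied to M^* with [U] and
    [V] exchanged; this conjugates the diagonal entries and so keeps their real parts. *)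
Lemma is_derive_vn_entropy_schmidt n m d (C : 'I_d -> R) (U : 'M[R[i]]_(n, d))
    (V : 'M[R[i]]_(m, d)) (M : R -> 'M[R[i]]_(n, m)) (M' : 'M[R[i]]_(n, m))
    (x : R) : d = minn n m ->
  (forall i, 0 < C i) -> U^t* *m U = 1%:M -> V^t* *m V = 1%:M ->
  M x = U *m real_diag C *m V^t* -> mxderive x M M' ->
  is_derive x 1 (fun t => vn_entropy (M t *m (M t)^t*))
    (- \sum_i (4 * (C i * ln (C i)) + 2 * C i)
         * complex.Re ((U^t* *m M' *m V) i i)).
Proof.
move=> dE C0 hU hV Mx dM.
have [nm|/ltnW mn] := leqP n m.
  have e : d = n by rewrite dE (minn_idPl nm).
  move: C U V C0 hU hV Mx; rewrite e => *.
  exact: is_derive_vn_entropy_square.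
have e : d = m by rewrite dE (minn_idPr mn).
move: C U V C0 hU hV Mx; rewrite e => C U V C0 hU hV Mx.
have Mx' : (M x)^t* = V *m real_diag C *m U^t*.
  by rewrite Mx !ctmxM trmxCK real_diag_adj mulmxA.
have := is_derive_vn_entropy_square C0 hV hU Mx' (mxderive_adj dM).
rewrite (_ : (fun t => _) = (fun t => vn_entropy (M t *m (M t)^t*))).
  move=> /is_derive_eq; apply; congr (- _); apply: eq_bigr => i _.
  congr (_ * _).
  have -> : V^t* *m M'^t* *m U = (U^t* *m M' *m V)^t*.
    by rewrite !ctmxM trmxCK mulmxA.
  by rewrite mxE mxE conj_complexE.
by apply/funext => t; rewrite trmxCK vn_entropy_gramC.
Qed.

End SchmidtForm.

(** * The entanglement generation rate *)

Section Rate.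
Variable R : realType.
Implicit Types (n d : nat).

Lemma evolutionN n (H : 'M[R[i]]_n) t : evolution H (- t) = (evolution H t)^t*.
Proof.
rewrite /evolution !hermfunE !ctmxM trmxCK mulmxA.
suff -> : diag_mx (map_mx (fun z : R[i] =>
      cos (complex.Re z * - t) -i* sin (complex.Re z * - t)) (spectral_diag H)) =
    (diag_mx (map_mx (fun z : R[i] =>
      cos (complex.Re z * t) -i* sin (complex.Re z * t)) (spectral_diag H)))^t*.
  by [].
apply/matrixP => i j; rewrite !mxE [j == i]eq_sym.
case: eqVneq => [->|_]; last by rewrite !mulr0n rmorph0.
by rewrite !mulr1n conj_complexE /= mulrN cosN sinN.
Qed.

Lemma evolution0 n (H : 'M[R[i]]_n) : evolution H 0 = 1%:M.
Proof.
rewrite -(hermfun1 H); apply: eq_hermfun => i.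
by rewrite mulr0 cos0 sin0 oppr0.
Qed.

Lemma is_derive_scaled (f : R -> R) (y l : R) : is_derive (0 : R) 1 f l ->
  is_derive (0 : R) 1 (fun t => f (y * t)) (l * y).
Proof.
move=> fl; apply: (@is_derive1_comp _ f (fun t => y * t)).
  by rewrite mulr0.
have := @is_deriveZ _ _ _ _ y _ _ _ (is_derive_id (0 : R) 1).
by rewrite /GRing.scale /= mulr1.
Qed.

Lemma cderive_phase (y : R) :
  cderive 0 (fun t => cos (y * t) -i* sin (y * t)) (- 'i%C * y%:C).
Proof.
split => /=; rewrite oppr0 !mul0r ?mulr0 ?subr0 ?add0r.
  have := is_derive_scaled y (is_derive_cos (0 : R)).
  by rewrite sin0 oppr0 mul0r.
have := is_deriveN (is_derive_scaled y (is_derive_sin (0 : R))).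
by rewrite cos0 mul1r mulN1r.
Qed.

Lemma mxderive_evolution n (H : 'M[R[i]]_n) : H \is hermsymmx ->
  mxderive 0 (evolution H) (- 'i%C *: H).
Proof.
move=> hH; set P := spectralmx H.
pose D t : 'M[R[i]]_n := diag_mx (map_mx (fun z : R[i] =>
  cos (complex.Re z * t) -i* sin (complex.Re z * t)) (spectral_diag H)).
have dD : mxderive 0 D (- 'i%C *: diag_mx (spectral_diag H)).
  move=> i j; rewrite !mxE.
  rewrite (_ : (fun t => _) = (fun t => (cos (eigval H i * t) -i*
      sin (eigval H i * t)) * (i == j)%:R)); last first.
    by apply/funext => t; rewrite !mxE mulr_natr.
  have := cderiveM (cderive_phase (eigval H i)) (cderive_cst 0 (i == j)%:R).
  rewrite mulr0 addr0 -mulrA mulr_natr.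
  rewrite /eigval RRe_real//.
  by have /mxOverP := hermitian_spectral_diag_real hH.
have := mxderiveMr P (mxderiveMl (invmx P) dD).
by rewrite -scalemxAr -scalemxAl -(spectralE hH).
Qed.

(** The coefficient matrix M of the state: the partial trace becomes M M^*, and the Schmidt
    decomposition becomes a singular value decomposition. *)
Definition bipartite_mx dA dB (phi : 'cV[R[i]]_(dA * dB)) : 'M[R[i]]_(dA, dB) :=
  \matrix_(i, j) phi (mxtens_index (i, j)) 0.

Lemma ptraceB_pure dA dB (phi : 'cV[R[i]]_(dA * dB)) :
  ptraceB (phi *m phi^t*) = bipartite_mx phi *m (bipartite_mx phi)^t*.
Proof.
apply/matrixP => i j; rewrite !mxE; apply: eq_bigr => k _.
by rewrite !mxE big_ord1 !mxE.
Qed.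

Definition col_family n d (a : 'I_d -> 'cV[R[i]]_n) : 'M[R[i]]_(n, d) :=
  \matrix_(i, j) a j i 0.

Lemma col_family_orthonormal n d (a : 'I_d -> 'cV[R[i]]_n) :
  orthonormal_family a -> (col_family a)^t* *m col_family a = 1%:M.
Proof.
move=> ha; apply/matrixP => i j; have := ha i j.
rewrite /braket mulmx1 !mxE => <-; apply: eq_bigr => k _.
by rewrite !mxE.
Qed.

Definition diag_kets dA dB d (a : 'I_d -> 'cV[R[i]]_dA) (b : 'I_d -> 'cV[R[i]]_dB)
  : 'M[R[i]]_(dA * dB, d) := col_family (fun i => tensor_ket (a i) (b i)).

Lemma tensor_ketE dA dB (u : 'cV[R[i]]_dA) (v : 'cV[R[i]]_dB) i j :
  tensor_ket u v (mxtens_index (i, j)) 0 = u i 0 * v j 0.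
Proof. by rewrite /tensor_ket mxE mxtens_indexK !ord1. Qed.

Lemma sum_mxtens dA dB (F : 'I_(dA * dB) -> R[i]) :
  \sum_k F k = \sum_i \sum_j F (mxtens_index (i, j)).
Proof.
rewrite pair_big (reindex (@mxtens_index dA dB)) /=; last first.
  exists (@mxtens_unindex dA dB) => k _; first exact: mxtens_indexK.
  exact: mxtens_unindexK.
by apply: eq_bigr => -[].
Qed.

Lemma orthonormal_diag_kets dA dB d (a : 'I_d -> 'cV[R[i]]_dA)
    (b : 'I_d -> 'cV[R[i]]_dB) :
  orthonormal_family a -> orthonormal_family b ->
  (diag_kets a b)^t* *m diag_kets a b = 1%:M.
Proof.
move=> ha hb; apply: col_family_orthonormal => i j.
rewrite /braket mulmx1 mxE sum_mxtens.
have -> : (i == j)%:R = (i == j)%:R * (i == j)%:R :> R[i].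
  by case: eqP; rewrite ?mulr1 ?mulr0.
rewrite -{1}ha -hb /braket !mulmx1 !mxE big_distrlr /=.
apply: eq_bigr => k _; apply: eq_bigr => l _.
by rewrite 2!mxE !tensor_ketE rmorphM !mxE mulrACA.
Qed.

(** The kets of B enter through a plain transpose, so the right singular vectors are their complex
    conjugates. *)
Lemma bipartite_mx_schmidt dA dB d (C : 'I_d -> R) (a : 'I_d -> 'cV[R[i]]_dA)
    (b : 'I_d -> 'cV[R[i]]_dB) :
  bipartite_mx (schmidt_state C a b) =
  col_family a *m real_diag C *m (map_mx Num.conj (col_family b))^t*.
Proof.
apply/matrixP => i j; rewrite mul_mx_diag !mxE /schmidt_state summxE.
by apply: eq_bigr => k _; rewrite [LHS]mxE tensor_ketE !mxE conjCK mulrCA mulrA.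
Qed.

Lemma bipartite_mx_diag dA dB d (phi : 'cV[R[i]]_(dA * dB))
    (a : 'I_d -> 'cV[R[i]]_dA) (b : 'I_d -> 'cV[R[i]]_dB) i :
  ((col_family a)^t* *m bipartite_mx phi *m map_mx Num.conj (col_family b)) i i =
  ((diag_kets a b)^t* *m phi) i 0.
Proof.
rewrite -mulmxA !mxE sum_mxtens; apply: eq_bigr => k _.
rewrite !mxE mulr_sumr; apply: eq_bigr => l _.
by rewrite !mxE mxtens_indexK !ord1 rmorphM mulrCA [RHS]mulrC.
Qed.

Lemma schmidt_stateE dA dB d (C : 'I_d -> R) (a : 'I_d -> 'cV[R[i]]_dA)
    (b : 'I_d -> 'cV[R[i]]_dB) :
  schmidt_state C a b = diag_kets a b *m \col_i (C i)%:C.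
Proof.
apply/matrixP => i j; rewrite ord1 mxE /schmidt_state summxE.
by apply: eq_bigr => k _; rewrite !mxE mulrC.
Qed.

(** The coefficient [op_coeff] at i j i j is <ii|H|jj>, and the C_j are real, so the sum over j
    assembles into Im <ii|H|psi>. *)
Lemma kcoefE dA dB d (C : 'I_d -> R) (a : 'I_d -> 'cV[R[i]]_dA)
    (b : 'I_d -> 'cV[R[i]]_dB) H i :
  kcoef C a b H i =
  complex.Im (((diag_kets a b)^t* *m (H *m schmidt_state C a b)) i 0).
Proof.
rewrite schmidt_stateE !mulmxA mxE ImC_sum; apply: eq_bigr => j _.
rewrite [X in _ = complex.Im (_ * X)]mxE mulrC [in RHS]mulrC ImCZ.
congr (_ * complex.Im _); rewrite /op_coeff /braket !mxE.
apply: eq_bigr => k _; rewrite !mxE; congr (_ * _).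
by apply: eq_bigr => l _; rewrite !mxE.
Qed.

Lemma ent_rateE dA dB (C : 'I_(minn dA dB) -> R)
    (a : 'I_(minn dA dB) -> 'cV[R[i]]_dA) (b : 'I_(minn dA dB) -> 'cV[R[i]]_dB)
    (H : 'M[R[i]]_(dA * dB)) :
  orthonormal_family a -> orthonormal_family b -> (forall i, 0 < C i) ->
  H \is hermsymmx ->
  ent_rate (schmidt_state C a b) H =
  - \sum_i (4 * (C i * ln (C i)) + 2 * C i) * kcoef C a b H i.
Proof.
move=> ha hb C0 hH; set psi := schmidt_state C a b.
pose M t := bipartite_mx (evolution H t *m psi).
have rhoE t : pure_entanglement
    (evolution H t *m (psi *m psi^t*) *m evolution H (- t)) =
    vn_entropy (M t *m (M t)^t*).
  rewrite /pure_entanglement /M -ptraceB_pure evolutionN (ctmxM (evolution H t) psi) !mulmxA.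
  by [].
have dM : mxderive 0 M (bipartite_mx (- 'i%C *: H *m psi)).
  move=> i j; rewrite mxE (_ : (fun t => _) =
    (fun t => (evolution H t *m psi) (mxtens_index (i, j)) 0)).
    exact: (mxderiveMr psi (mxderive_evolution hH)).
  by apply/funext => t; rewrite mxE.
have M0 : M 0 = col_family a *m real_diag C *m
    (map_mx Num.conj (col_family b))^t*.
  by rewrite /M evolution0 mul1mx bipartite_mx_schmidt.
have hV : (map_mx Num.conj (col_family b))^t* *m map_mx Num.conj (col_family b)
    = 1%:M.
  have := congr1 (map_mx Num.conj) (col_family_orthonormal hb).
  rewrite map_mxM map_mx1 => <-; congr (_ *m _).
  by apply/matrixP => i j; rewrite !mxE.
have dS := is_derive_vn_entropy_schmidt erefl C0 (col_family_orthonormal ha) hV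
  M0 dM.
rewrite /ent_rate derive1E (_ : (fun t => _) =
  (fun t => vn_entropy (M t *m (M t)^t*))); last exact/funext.
rewrite derive_val; congr (- _); apply: eq_bigr => i _; congr (_ * _).
(* The diagonal entry is -i <ii|H|psi>, and Re (-i z) = Im z. *)
rewrite bipartite_mx_diag kcoefE -scalemxAl -scalemxAr mxE -/psi.
by case: (_ i 0) => x y /=; rewrite oppr0 mul0r sub0r mulN1r opprK.
Qed.

End Rate.

(** * Energy variance *)

Section Variance.
Variable R : realType.
Implicit Types (n d : nat).

Lemma dot_self n (u : 'cV[R[i]]_n) :
  complex.Re ((u^t* *m u) 0 0) =
  \sum_i (complex.Re (u i 0) ^+ 2 + complex.Im (u i 0) ^+ 2).
Proof.
rewrite mxE ReC_sum; apply: eq_bigr => i _.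
by rewrite !mxE conj_complexE; case: (u i 0) => x y /=; ring.
Qed.

(** Pythagoras for u = E c + w, with c = E^* u and w orthogonal to the columns of [E]. *)
Lemma bessel n d (E : 'M[R[i]]_(n, d)) (u : 'cV[R[i]]_n) :
  E^t* *m E = 1%:M ->
  complex.Re (((E^t* *m u)^t* *m (E^t* *m u)) 0 0) <=
  complex.Re ((u^t* *m u) 0 0).
Proof.
move=> hE; pose w := u - E *m (E^t* *m u).
have Ew : E^t* *m w = 0 by rewrite mulmxBr !mulmxA hE mul1mx subrr.
have wE : w^t* *m E = 0 by rewrite -(trmxCK E) -ctmxM Ew trmx0 map_mx0.
have uE : u = E *m (E^t* *m u) + w by rewrite addrC subrK.
move: (E^t* *m u) w Ew wE uE => c w Ew wE ->.
have -> : (E *m c + w)^t* *m (E *m c + w) = c^t* *m c + w^t* *m w.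
  have -> : (E *m c + w)^t* = c^t* *m E^t* + w^t*.
    by rewrite raddfD /= map_mxD ctmxM.
  rewrite mulmxDl !mulmxDr (mulmxA (w^t*)) wE mul0mx add0r.
  rewrite -(mulmxA _ _ w) Ew mulmx0 addr0.
  by rewrite mulmxA -(mulmxA _ _ E) hE mulmx1.
rewrite [X in _ <= complex.Re X]mxE ReCD lerDl dot_self.
by apply: sumr_ge0 => i _; rewrite addr_ge0// sqr_ge0.
Qed.

Lemma herm_expectation_real n (H : 'M[R[i]]_n) (psi : 'cV[R[i]]_n) :
  H \is hermsymmx -> complex.Im (braket psi H psi) = 0.
Proof.
rewrite hermsymmx_adj => /eqP hH; rewrite /braket.
set X := _ *m _; have XX : X^t* = X.
  by rewrite /X !ctmxM hH trmxCK mulmxA.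
have := congr1 (fun Z : 'M[R[i]]_1 => complex.Im (Z ord0 ord0)) XX.
rewrite /= 2!mxE conj_complexE /=; lra.
Qed.

Definition real_col d (k : 'I_d -> R) : 'cV[R[i]]_d := \col_i (k i)%:C.

Section SchmidtSubspace.
Variables (n d : nat) (E : 'M[R[i]]_(n, d)) (C : 'I_d -> R).
Hypothesis hE : E^t* *m E = 1%:M.
Hypothesis hC : \sum_i C i ^+ 2 = 1.

Let psi := E *m real_col C.
Let im_amp (H : 'M[R[i]]_n) i := complex.Im ((E^t* *m (H *m psi)) i 0).

Lemma dot_real_col (k l : 'I_d -> R) :
  (E *m real_col k)^t* *m (E *m real_col l) = (\sum_i k i * l i)%:C%:M.
Proof.
rewrite ctmxM mulmxA -(mulmxA _ (E^t*)) hE mulmx1.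
apply/matrixP => i j; rewrite !ord1 !mxE rmorph_sum; apply: eq_bigr => m _.
by rewrite !mxE conj_complexE /= oppr0 rmorphM.
Qed.

Lemma dot_psi : psi^t* *m psi = 1%:M.
Proof.
rewrite dot_real_col; under eq_bigr do rewrite -expr2.
by rewrite hC.
Qed.

Lemma sum_im_amp (H : 'M[R[i]]_n) : H \is hermsymmx ->
  \sum_i C i * im_amp H i = 0.
Proof.
move=> hH; apply: etrans (herm_expectation_real psi hH); rewrite /braket.
rewrite -mulmxA /psi ctmxM -!mulmxA -/psi mxE ImC_sum.
apply: eq_bigr => i _; rewrite -ImCZ; congr (complex.Im (_ * _)).
by rewrite !mxE conj_complexE /= oppr0.
Qed.

(** Centering at the real expectation h turns the variance into the squared norm of (H - h) psi, to
    which Bessel's inequality applies. *)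
Lemma energy_varianceE (H : 'M[R[i]]_n) : H \is hermsymmx ->
  let h := complex.Re (braket psi H psi) in
  let phi := H *m psi - h%:C *: psi in
  energy_variance psi H = complex.Re ((phi^t* *m phi) 0 0).
Proof.
move=> hH h phi; have hI := herm_expectation_real psi hH.
have hb : braket psi H psi = h%:C.
  by rewrite /h; case: (braket _ _ _) hI => x y /= ->.
rewrite /energy_variance hb /phi.
have hH' : H^t* = H by apply/eqP; rewrite -hermsymmx_adj.
have -> : (H *m psi - h%:C *: psi)^t* = psi^t* *m H - h%:C *: psi^t*.
  by rewrite ctmxB ctmxZ conj_real ctmxM hH'.
rewrite mulmxBl !mulmxBr -!scalemxAl -!scalemxAr dot_psi.
have e1 : psi^t* *m H *m psi = h%:C%:M.
  by rewrite [LHS]mx11_scalar -[in RHS]hb.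
have e2 : psi^t* *m (H *m psi) = h%:C%:M by rewrite mulmxA.
have e3 : psi^t* *m H *m (H *m psi) = (braket psi (H *m H) psi)%:M.
  by rewrite [LHS]mx11_scalar /braket !mulmxA.
rewrite e1 e2 e3.
move: (braket psi _ psi) => z; congr complex.Re.
rewrite !mxE eqxx !mulr1n mulr1 expr2; ring.
Qed.

(** Subtracting h psi changes only the real parts of the amplitudes, because the Schmidt
    coefficients are real; Bessel's inequality then bounds the imaginary parts. *)
Lemma sum_sqr_im_amp_le (H : 'M[R[i]]_n) : H \is hermsymmx ->
  \sum_i im_amp H i ^+ 2 <= energy_variance psi H.
Proof.
move=> hH; rewrite energy_varianceE//; set h := complex.Re (braket _ _ _).
apply: le_trans (bessel _ hE); rewrite dot_self; apply: ler_sum => i _.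
suff -> : im_amp H i = complex.Im ((E^t* *m (H *m psi - h%:C *: psi)) i 0).
  by rewrite lerDr sqr_ge0.
have -> : E^t* *m (H *m psi - h%:C *: psi) =
    E^t* *m (H *m psi) - h%:C *: real_col C.
  by rewrite mulmxBr -scalemxAr /psi (mulmxA (E^t*) E) hE mul1mx.
rewrite /im_amp; move: (E^t* *m (H *m psi)) => v.
by rewrite !mxE ImCD -rmorphM /= oppr0 addr0.
Qed.

Section Attained.
Variable k : 'I_d -> R.
Hypothesis hk : \sum_i C i * k i = 0.

Definition generator : 'M[R[i]]_n :=
  'i%C *: (E *m real_col k *m psi^t* - psi *m (E *m real_col k)^t*).

Lemma generator_herm : generator \is hermsymmx.
Proof.
rewrite hermsymmx_adj; apply/eqP.
rewrite /generator; move: (E *m real_col k) => u.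
by rewrite ctmxZ ctmxB conj_i !ctmxM !trmxCK scaleNr -scalerN opprB.
Qed.

(** Only one term survives, as psi is a unit vector orthogonal to kappa. The amplitudes are purely
    imaginary, so no variance is spent on real parts. *)
Lemma generator_psi : generator *m psi = 'i%C *: (E *m real_col k).
Proof.
rewrite /generator -scalemxAl mulmxBl -(mulmxA _ (psi^t*)) dot_psi mulmx1.
rewrite -(mulmxA psi).
have -> : (E *m real_col k)^t* *m psi = 0.
  rewrite dot_real_col (_ : \sum_i _ = 0) ?raddf0 //.
  by rewrite -[RHS]hk; apply: eq_bigr => i _; rewrite mulrC.
by rewrite mulmx0 subr0.
Qed.

Lemma generator_im_amp i : im_amp generator i = k i.
Proof.
rewrite /im_amp generator_psi -scalemxAr mulmxA hE mul1mx !mxE /=.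
by rewrite !mul0r ?mul1r add0r.
Qed.

Lemma generator_variance : energy_variance psi generator = \sum_i k i ^+ 2.
Proof.
rewrite energy_varianceE ?generator_herm//.
have -> : complex.Re (braket psi generator psi) = 0.
  rewrite /braket -mulmxA generator_psi -scalemxAr dot_real_col hk.
  by rewrite (_ : 0%:C%:M = 0) ?scaler0 ?mxE// raddf0.
rewrite scale0r subr0 generator_psi.
rewrite ctmxZ conj_i.
rewrite -scalemxAl -scalemxAr scalerA dot_real_col.
have -> : - 'i%C * 'i%C = 1 :> R[i] by rewrite mulNr -expr2 sqr_i opprK.
rewrite scale1r mxE eqxx mulr1n /=.
by apply: eq_bigr => i _; rewrite expr2.
Qed.

End Attained.
End SchmidtSubspace.
End Variance.

(** * Maximizing the rate *)

Section LinearOptimization.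
Variables (R : realType) (d : nat) (C h : 'I_d -> R).
Hypothesis hC : \sum_i C i ^+ 2 = 1.

(** Here [s] is the component of [h] along the unit vector [C], [w] is the orthogonal remainder and
    [W] is its norm. In the application, [s] and - W / 2 become the Lagrange multipliers. *)
Let s := \sum_i C i * h i.
Let w i := h i - s * C i.
Let W := Num.sqrt (\sum_i w i ^+ 2).

Lemma sum_orth_proj : \sum_i C i * w i = 0.
Proof.
under eq_bigr do rewrite /w mulrBr mulrCA -expr2.
by rewrite sumrB -mulr_sumr hC mulr1 subrr.
Qed.

Lemma sum_orth_projr (k : 'I_d -> R) : \sum_i C i * k i = 0 ->
  \sum_i h i * k i = \sum_i w i * k i.
Proof.
move=> hk; under [RHS]eq_bigr do rewrite /w mulrBl -mulrA.
by rewrite sumrB -mulr_sumr hk mulr0 subr0.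
Qed.

Lemma sqr_norm_proj : W ^+ 2 = \sum_i w i ^+ 2.
Proof. by rewrite sqr_sqrtr// sumr_ge0// => i _; rewrite sqr_ge0. Qed.

Lemma norm_proj_ge0 : 0 <= W. Proof. exact: sqrtr_ge0. Qed.

(* When [W = 0] this is the zero vector, because division by zero is zero. *)
Definition steepest i := - w i / W.

Lemma steepest_orth : \sum_i C i * steepest i = 0.
Proof.
under eq_bigr do rewrite /steepest mulrA mulrN.
by rewrite -mulr_suml sumrN sum_orth_proj oppr0 mul0r.
Qed.

Lemma sum_sqr_steepest : \sum_i steepest i ^+ 2 = (W != 0)%:R.
Proof.
under eq_bigr do rewrite /steepest exprMn sqrrN.
rewrite -mulr_suml -sqr_norm_proj -exprMn.
by have [->|W0] := eqVneq W 0; rewrite ?mul0r ?expr0n// divff// expr1n.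
Qed.

Lemma steepestE i : w i = - W * steepest i.
Proof.
rewrite /steepest; have [W0|W0] := eqVneq W 0; last by field.
rewrite W0 oppr0 mul0r; apply/eqP; rewrite -sqrf_eq0.
have := sqr_norm_proj; rewrite W0 expr0n /= => /esym/eqP.
by rewrite psumr_eq0 => [/allP/(_ i)|j _]; rewrite ?sqr_ge0 ?mem_index_enum//; apply.
Qed.

Lemma sum_steepest : - \sum_i w i * steepest i = W.
Proof.
under eq_bigr do rewrite steepestE -mulrA -expr2.
rewrite -mulr_sumr sum_sqr_steepest.
by have [->|_] := eqVneq W 0; rewrite ?mulr1 ?mulr0 ?opprK ?oppr0.
Qed.

(** The equality case of Cauchy-Schwarz: |w + W k|^2 = W^2 + 2 W <w,k> + W^2 |k|^2 is at most 0
    under the two hypotheses. No division by [W] occurs, so W = 0 is covered. *)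
Lemma optimal_multiplier (k : 'I_d -> R) :
  \sum_i k i ^+ 2 <= 1 -> W <= - \sum_i w i * k i ->
  forall i, w i = - W * k i.
Proof.
move=> k1 Wk i; have W0 := norm_proj_ge0.
suff /eqP : \sum_j (w j + W * k j) ^+ 2 = 0.
  rewrite psumr_eq0 => [/allP/(_ i)|j _]; last by rewrite sqr_ge0.
  rewrite mem_index_enum sqrf_eq0 => /(_ isT)/eqP; lra.
apply/eqP; rewrite eq_le sumr_ge0 ?andbT => [|j _]; last by rewrite sqr_ge0.
have -> : \sum_j (w j + W * k j) ^+ 2 =
    W ^+ 2 + 2 * W * (\sum_j w j * k j) + W ^+ 2 * \sum_j k j ^+ 2.
  rewrite sqr_norm_proj !mulr_sumr -!big_split /=.
  apply: eq_bigr => j _; rewrite -sqr_norm_proj; ring.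
have : W * W <= W * - \sum_i0 w i0 * k i0 by rewrite ler_wpM2l.
have : W ^+ 2 * \sum_j k j ^+ 2 <= W ^+ 2 * 1 by rewrite ler_wpM2l// sqr_ge0.
rewrite expr2; lra.
Qed.

(** After substituting w = - W l the claim is W <l,k> <= W, which follows from l_i k_i <= (l_i^2 +
    k_i^2) / 2. *)
Lemma rate_bound (k l : 'I_d -> R) : \sum_i k i ^+ 2 <= 1 ->
  \sum_i l i ^+ 2 = 1 -> (forall i, w i = - W * l i) ->
  - \sum_i w i * k i <= - \sum_i w i * l i.
Proof.
move=> k1 l1 wl; have W0 := norm_proj_ge0.
under eq_bigr do rewrite wl -mulrA; rewrite -mulr_sumr.
under [in leRHS]eq_bigr do rewrite wl -mulrA -expr2; rewrite -mulr_sumr l1.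
rewrite mulr1 mulNr !opprK -[leRHS]mulr1 ler_wpM2l//.
apply: (@le_trans _ _ (\sum_i (l i ^+ 2 + k i ^+ 2) / 2)).
  apply: ler_sum => i _; have := sqr_ge0 (l i - k i); nra.
rewrite -mulr_suml big_split /= l1; lra.
Qed.

(** Serves the degenerate case W = 0, where [steepest] is zero. The witness is the normalized vector
    (C_1, - C_0, 0, ..., 0), with indices from 0. *)
Lemma exists_unit_orth : (1 < d)%N -> (forall i, 0 < C i) ->
  exists l : 'I_d -> R, \sum_i C i * l i = 0 /\ \sum_i l i ^+ 2 = 1.
Proof.
move=> d1 C0; pose i0 := Ordinal (ltnW d1); pose i1 := Ordinal d1.
pose N := Num.sqrt (C i0 ^+ 2 + C i1 ^+ 2).
have N2 : N ^+ 2 = C i0 ^+ 2 + C i1 ^+ 2.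
  by rewrite sqr_sqrtr// addr_ge0// sqr_ge0.
have N0 : N != 0.
  by rewrite gt_eqF// sqrtr_gt0 addr_gt0// exprn_gt0.
exists (fun i => (if i == i0 then C i1 else if i == i1 then - C i0 else 0) / N).
split; rewrite (bigD1 i0)//= (bigD1 i1)//=.
  rewrite big1 => [|i /andP[/negbTE -> /negbTE ->]]; last by rewrite mul0r mulr0.
  by field.
rewrite big1 => [|i /andP[/negbTE -> /negbTE ->]]; last first.
  by rewrite mul0r expr0n.
rewrite addr0 !exprMn -mulrDl sqrrN addrC -N2 -exprMn divff//.
by rewrite expr1n.
Qed.

End LinearOptimization.

(** Both logarithms equal [s]. Consequently W = 0 only if all Schmidt coefficients coincide. *)
Lemma pos_mul_ln_inj (R : realType) (x y s : R) : 0 < x -> 0 < y ->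
  x * ln x = s * x -> y * ln y = s * y -> x = y.
Proof.
move=> x0 y0 hx hy; apply: ln_inj; rewrite ?posrE//.
apply: (@etrans _ _ s).
  by apply: (mulfI (lt0r_neq0 x0)); rewrite hx mulrC.
by apply: (mulfI (lt0r_neq0 y0)); rewrite hy mulrC.
Qed.

(** If all C_i coincide, the rate vanishes for every Hermitian [H], so H = 0 is a maximizer with k =
    0; hence the normalization of an arbitrary maximizer is claimed for unequal C_i. In Schmidt
    dimension 1, orthogonality to [C] forces k = 0; hence the dimension bound for a maximizer
    satisfying all equations. *)
Theorem theorem3 (R : realType) (dA dB : nat)
    (C : 'I_(minn dA dB) -> R)
    (a : 'I_(minn dA dB) -> 'cV[R[i]]_dA)
    (b : 'I_(minn dA dB) -> 'cV[R[i]]_dB)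
    (psi : 'cV[R[i]]_(dA * dB))
    (ha : orthonormal_family a) (hb : orthonormal_family b)
    (hC : forall i, 0 < C i)
    (hpsi : psi = schmidt_state C a b)
    (hnorm : \sum_i C i ^+ 2 = 1) :
  (forall H : 'M[R[i]]_(dA * dB), maximizes_rate psi H ->
     let k := kcoef C a b H in
     \sum_i C i * k i = 0 /\
     ((exists i j, C i <> C j) -> \sum_i k i ^+ 2 = 1) /\
     exists lam1 lam2 : R, forall i,
       C i * ln (C i) - 2 * lam1 * k i - lam2 * C i = 0)
  /\
  ((1 < minn dA dB)%N ->
   exists H : 'M[R[i]]_(dA * dB), maximizes_rate psi H /\
     let k := kcoef C a b H in
     \sum_i C i * k i = 0 /\
     \sum_i k i ^+ 2 = 1 /\
     exists lam1 lam2 : R, forall i,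
       C i * ln (C i) - 2 * lam1 * k i - lam2 * C i = 0).
Proof.
have hE := orthonormal_diag_kets ha hb.
set E := diag_kets a b in hE.
have psiE : psi = E *m real_col C by rewrite hpsi schmidt_stateE.
pose h i := C i * ln (C i); pose s := \sum_i C i * h i.
pose w i := h i - s * C i; pose W := Num.sqrt (\sum_i w i ^+ 2).
have kE H i : kcoef C a b H i =
    complex.Im ((E^t* *m (H *m (E *m real_col C))) i 0).
  by rewrite kcoefE -hpsi -psiE.
have kC H : H \is hermsymmx -> \sum_i C i * kcoef C a b H i = 0.
  move=> hH; under eq_bigr do rewrite kE.
  exact: sum_im_amp.
have kV H : admissible psi H -> \sum_i kcoef C a b H i ^+ 2 <= 1.
  move=> [hH]; apply: le_trans; under eq_bigr do rewrite kE.
  by rewrite psiE; exact: sum_sqr_im_amp_le.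
(* Orthogonality of k to [C] removes the term 2 C_i and also replaces h by its projection w. *)
have rateE H : H \is hermsymmx ->
    ent_rate psi H = 4 * - \sum_i w i * kcoef C a b H i.
  move=> hH; rewrite hpsi ent_rateE// -(sum_orth_projr h (kC H hH)).
  have -> : \sum_i (4 * (C i * ln (C i)) + 2 * C i) * kcoef C a b H i =
      4 * (\sum_i h i * kcoef C a b H i) + 2 * \sum_i C i * kcoef C a b H i.
    by rewrite !mulr_sumr -big_split; apply: eq_bigr => i _; rewrite /h /=; ring.
  by rewrite kC// mulr0 addr0 mulrN.
have gen (l : 'I_(minn dA dB) -> R) : \sum_i C i * l i = 0 ->
    \sum_i l i ^+ 2 <= 1 -> exists H, admissible psi H /\
    kcoef C a b H = l.
  move=> Cl l1; exists (generator E C l); split.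
    split; first exact: generator_herm.
    by rewrite psiE (generator_variance hE hnorm Cl).
  by apply/funext => i; rewrite kE (generator_im_amp hE hnorm Cl).
have mult (l : 'I_(minn dA dB) -> R) : (forall i, w i = - W * l i) ->
    exists lam1 lam2 : R, forall i,
      C i * ln (C i) - 2 * lam1 * l i - lam2 * C i = 0.
  (* The choice makes 2 lam1 = - W, so the equation is h_i - s C_i = - W k_i. *)
  move=> wl; exists (- W / 2), s => i; have := wl i; rewrite /w /h => e.
  by rewrite (_ : 2 * (- W / 2) = - W); [lra | field].
split.
  move=> H [[hH vH] maxH] /=; have k1 := kV H (conj hH vH).
  have st1 : \sum_i steepest C h i ^+ 2 <= 1.
    by rewrite sum_sqr_steepest; case: eqP.
  (* The competitor [G] realizes [steepest] and has rate 4 W, so maximality of [H] yields W <= -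
     <w,k>. *)
  have [G [aG kG]] := gen _ (steepest_orth h hnorm) st1.
  have := maxH G aG; rewrite (rateE _ hH) (rateE _ (proj1 aG)).
  rewrite kG sum_steepest// ler_pM2l// => Wk.
  have wk := optimal_multiplier k1 Wk.
  split; first exact: kC.
  split; last exact: mult.
  move=> [i [j Cij]].
  have W0 : W != 0.
    apply/eqP => W0; apply: Cij; apply: (@pos_mul_ln_inj _ _ _ s) => //.
      by have := wk i; rewrite -/W W0 oppr0 mul0r => /eqP; rewrite subr_eq0 => /eqP.
    by have := wk j; rewrite -/W W0 oppr0 mul0r => /eqP; rewrite subr_eq0 => /eqP.
  (* Taking norms in w = - W k; cancelling W^2 leaves the normalization. *)
  have : W ^+ 2 = W ^+ 2 * \sum_i kcoef C a b H i ^+ 2.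
    rewrite {1}sqr_norm_proj mulr_sumr; apply: eq_bigr => m _.
    by rewrite (wk m) exprMn sqrrN.
  rewrite -[LHS]mulr1 => /mulfI <- //.
  by rewrite expf_neq0.
move=> d1.
have [l [Cl [l1 wl]]] : exists l : 'I_(minn dA dB) -> R,
    \sum_i C i * l i = 0 /\ \sum_i l i ^+ 2 = 1 /\ forall i, w i = - W * l i.
  (* If W = 0 then w = 0, and any unit vector orthogonal to [C] satisfies w = - W l. *)
  have [W0|W0] := eqVneq W 0; last first.
    exists (steepest C h); split; first exact: steepest_orth.
    by split; [rewrite sum_sqr_steepest W0 | exact: steepestE].
  have [l [Cl l1]] := exists_unit_orth d1 hC.
  exists l; split=> //; split=> // i.
  have := steepestE C h i; rewrite -/W W0 !oppr0 !mul0r.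
  by [].
have l1' : \sum_i l i ^+ 2 <= 1 by rewrite l1.
have [H [aH kH]] := gen l Cl l1'.
exists H; split.
  split; first exact: aH.
  move=> H' aH'; rewrite (rateE _ (proj1 aH)) (rateE _ (proj1 aH')).
  by rewrite kH ler_pM2l//; apply: rate_bound => //; exact: kV.
by rewrite /= kH; split=> //; split=> //; exact: mult.
Qed.
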